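(* Let $k>0$ and $r\ge 1$ be integers, let $c=3k+3$, and let $W$ be an $r\times c$ grid storage area with $n=rc$ loads labeled $1,\dots,n$ and planned departure sequence $D=(1,2,\dots,n)$. Then for every arrival sequence $A$ (every ordering of the $n$ loads), the instance $(r,c,A,D,k)$ has a zero-relocation solution.
   Context: Storage area. $W$ is a rectangular grid of cells with $r$ rows and $c$ columns; each cell holds at most one load. The bottom row is the open side of $W$: below it lies an additional row of $c$ cells, the I/O row, each of whose cells is adjacent to the bottom-row cell directly above it (and to its horizontal neighbors in the I/O row). Two cells are adjacent if they are horizontally or vertically adjacent. Loads enter and leave only through the I/O row, and the I/O row is not used for storage. Actions. Loads are moved one at a time along paths of empty cells in the four cardinal directions, inside $W$ together with the I/O row. A storage action moves an arriving load, which appears on some cell of the I/O row, along a path of empty cells to an empty cell of $W$. A retrieval action moves a load from its cell in $W$ along a path of otherwise empty cells to some cell of the I/O row, after which the load disappears. A relocation action moves a load to another empty cell of $W$ or of the I/O row along a path of empty cells. An arrangement of the loads is an injective map from the set of loads to the cells of $W$. $k$-bounded perturbation. A permutation $\tilde S$ of a sequence $S=(s_1,\dots,s_n)$ of distinct elements is a $k$-bounded perturbation of $S$ if for every $i<j$ such that $s_j$ appears before $s_i$ in $\tilde S$ one has $j-i\le k$. Zero-relocation solution. An instance consists of $r,c$, an arrival sequence $A$, the planned departure sequence $D$, and $k$. All loads are first stored in $W$ in the order $A$; then they are retrieved in the order of some $k$-bounded perturbation $\tilde D$ of $D$ that is unknown during storage (and is revealed one load at a time during retrieval). A zero-relocation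 solution uses only one storage action and one retrieval action per load, for every possible $\tilde D$. That is, the instance has a zero-relocation solution if there is an arrangement $\mathcal A$ such that, starting from empty $W$, the loads can be stored in the order $A$ using exactly one storage action per load, ending in $\mathcal A$, and, for every $k$-bounded perturbation $\tilde D$ of $D$, starting from $\mathcal A$, the loads can be retrieved in the order $\tilde D$ using exactly one retrieval action per load. *)

(* Defs.v *)
From HB Require Import structures.
From mathcomp Require Import all_boot.

Set Implicit Arguments.
Unset Strict Implicit.
Unset Printing Implicit Defensive.

Section BoundedPerturbation.

Variable T : eqType.

(* Meant for duplicate-free S, so that [index x S'] is the position of x. *)
Definition bounded_perturbation (k : nat) (S S' : seq T) : Prop :=
  perm_eq S' S /\
  forall (x0 : T) (i j : nat), i < j < size S ->
    index (nth x0 S j) S' < index (nth x0 S i) S' -> j - i <= k.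

End BoundedPerturbation.

Section Storage.

Variables (r c : nat).

(* A cell of W is (row, column), with row 0 the bottom row (the open side). *)
Definition wcell : Type := ('I_r * 'I_c)%type.

(* A cell of W together with the I/O row: row 0 is the I/O row and row i.+1
   is row i of W. *)
Definition cell : Type := ('I_r.+1 * 'I_c)%type.

Definition cell_of_wcell (w : wcell) : cell := (lift ord0 w.1, w.2).

Definition is_io (p : cell) : bool := p.1 == ord0.

Definition consecutive (m n : nat) : bool := (m.+1 == n) || (n.+1 == m).

Definition adjacent : rel cell := fun p q =>
  ((p.1 == q.1) && consecutive p.2 q.2) ||
  ((p.2 == q.2) && consecutive p.1 q.1).

Variable L : finType.

(* The position of each load; None means that the load is not present, i.e.
   has not arrived yet or has already left. *)
Definition config : Type := {ffun L -> option cell}.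

Definition no_load : config := [ffun _ => None].

Definition set_load (f : config) (x : L) (o : option cell) : config :=
  [ffun y => if y == x then o else f y].

Definition is_empty (f : config) (p : cell) : bool :=
  [forall x, f x != Some p].

Definition empty_path (f : config) (p q : cell) : Prop :=
  exists s : seq cell,
    [/\ path adjacent p s, last p s = q & all (is_empty f) (p :: s)].

Definition storage_action (x : L) (f g : config) : Prop :=
  f x = None /\
  exists (p : cell) (w : wcell),
    [/\ is_io p, empty_path f p (cell_of_wcell w)
      & g = set_load f x (Some (cell_of_wcell w))].

(* The moving load x does not obstruct its own path, hence the path is empty
   in the configuration from which x has been removed. *)
Definition retrieval_action (x : L) (f g : config) : Prop :=
  exists (w : wcell) (q : cell),
    [/\ f x = Some (cell_of_wcell w), is_io q,
        empty_path (set_load f x None) (cell_of_wcell w) q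
      & g = set_load f x None].

(* One action for each load of s, in the order of s, leading from f to g. *)
Fixpoint perform (action : L -> config -> config -> Prop) (s : seq L)
    (f g : config) : Prop :=
  if s is x :: s' then exists2 h, action x f h & perform action s' h g
  else f = g.

Definition config_of (a : {ffun L -> wcell}) : config :=
  [ffun x => Some (cell_of_wcell (a x))].

(* A and D are meant to be orderings of all the loads. *)
Definition zero_relocation_solution (A D : seq L) (k : nat) : Prop :=
  exists a : {ffun L -> wcell},
    [/\ injective a,
        perform storage_action A no_load (config_of a)
      & forall D' : seq L, bounded_perturbation k D D' ->
          perform retrieval_action D' (config_of a) no_load].

End Storage.

(* Main.v *)
(* In a k-bounded perturbation two loads with the same residue mod k+1 keep
   their order, so giving each residue class its own three columns reduces the
   problem to 3 columns and exact departures.  Within such a block, fill the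
   columns from the bottom, comparing the last arrival a and the first departure
   d among the loads still to be placed.  If a = d, this load goes to the right
   column; otherwise a goes to the middle column and d to the left one.  Each
   load can then leave through its own or a neighbouring column, all of whose
   cells up to its row have been vacated before: in reverse arrival order the
   middle or right column, in departure order the left or right column.  When
   the right column is full, it serves as a common lane for the middle one;
   when the other two are full, the remaining loads go right in departure
   order. *)

Require Import Defs.
From HB Require Import structures.
From mathcomp Require Import all_boot.
From mathcomp Require Import zify.

Set Implicit Arguments.
Unset Strict Implicit.
Unset Printing Implicit Defensive.

(** * Arranging one residue class in a block of three columns *)

Section Lanes.

Variable T : finType.
Implicit Types (rk : T -> nat) (S : {set T}) (p : T -> nat * nat).

(* [rk] is an order of removal: when x leaves, no load remains in column j at or
   below the row of x. *)
Definition lane_free rk S p (x : T) (j : nat) : Prop :=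
  forall y, y \in S -> y != x -> (p y).2 = j -> (p y).1 <= (p x).1 ->
    rk y < rk x.

Definition add_pos p (u : T) (w : nat * nat) : T -> nat * nat :=
  fun y => if y == u then w else p y.

(** A newly placed load can block only the column it occupies, so extending a lane of an earlier
    load costs at most one rank comparison. *)
Lemma lane_free_add rk S p u w x j :
  x != u -> lane_free rk (S :\ u) p x j -> (w.2 = j -> rk u < rk x) ->
  lane_free rk S (add_pos p u w) x j.
Proof.
move=> xu fx ux y yS yx; rewrite /add_pos (negbTE xu).
case: eqP => [-> /ux //|/eqP yu]; apply: fx => //.
by rewrite !inE yu.
Qed.

Lemma lane_free_new rk S p u w j :
  (forall y, y \in S :\ u -> (p y).2 = j -> (p y).1 <= w.1 -> rk y < rk u) ->
  lane_free rk S (add_pos p u w) u j.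
Proof.
move=> fu y yS yu; rewrite /add_pos (negbTE yu) eqxx => yj yw.
by apply: fu => //; rewrite !inE yu.
Qed.

Lemma add_pos_inj S p u w :
  {in S :\ u &, injective p} -> (forall y, y \in S :\ u -> p y != w) ->
  {in S &, injective (add_pos p u w)}.
Proof.
move=> pinj pw x y xS yS; rewrite /add_pos.
case: (eqVneq x u) => [->|xu]; case: (eqVneq y u) => [->|yu] //.
- by move=> e; move: (pw y); rewrite !inE yu yS e eqxx => /(_ isT).
- by move=> e; move: (pw x); rewrite !inE xu xS e eqxx => /(_ isT).
by apply: pinj; rewrite !inE ?xu ?yu.
Qed.

Lemma min_rank rk S : injective rk -> S != set0 ->
  exists2 u, u \in S & forall y, y \in S -> y != u -> rk u < rk y.
Proof.
move=> rki /set0Pn[x0 x0S]; case: (arg_minnP rk x0S) => u uS umin.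
exists u => // y yS yu; rewrite ltn_neqAle umin // andbT.
by apply: contra_neq yu => /rki.
Qed.

(* S is the set of loads still to be placed when columns 0 and 1 are filled up
   to row m and column 2 up to row q; rkA ranks loads by reverse arrival. *)
Lemma block_arrangement (rkA rkD : T -> nat) (r m q : nat) (S : {set T}) :
  injective rkA -> injective rkD -> m <= r -> q <= r ->
  #|S| = 2 * (r - m) + (r - q) ->
  exists p : T -> nat * nat,
    [/\ {in S &, injective p},
        {in S, forall x, [/\ (p x).1 < r, (p x).2 < 3 &
           (if (p x).2 == 2 then q else m) <= (p x).1]},
        {in S, forall x, lane_free rkA S p x 1 \/
           [/\ m < r, 0 < (p x).2 & lane_free rkA S p x 2]} &
        {in S, forall x, ((p x).2 <= 1 /\ lane_free rkD S p x 0) \/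
           (0 < (p x).2 /\ lane_free rkD S p x 2)}].
Proof.
(* Strong induction, since a round places either one load or two. *)
move=> iA iD; have [N] := ubnP #|S|.
elim: N S m q => // N IH S m q leN mr qr cardS.
have [S0|Sn0] := eqVneq S set0.
  by exists (fun=> (0, 0)); rewrite S0; split=> x; rewrite ?in_set0.
have [a aS amin] := min_rank iA Sn0; have [d dS dmin] := min_rank iD Sn0.
have [c1|c2] := boolP ((m == r) || ((a == d) && (q < r))).
  have qr' : q < r.
    case/orP: c1 => [/eqP em|/andP[] //].
    by move: Sn0; rewrite -card_gt0 cardS; lia.
  have cS := cardsD1 d S; rewrite dS in cS.
  have [||||p [pinj psh pA pD]] := IH (S :\ d) m q.+1; [lia|lia|lia|lia|].
  have psh' y : y \in S :\ d -> (p y).2 = 2 -> q < (p y).1.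
    by move=> /psh[_ _] /[swap] ->.
  exists (add_pos p d (q, 2)); split.
  - apply: add_pos_inj => // y yS; apply/eqP=> e.
    by have := psh' y yS; rewrite e /= ltnn => /(_ erefl).
  - move=> y yS; rewrite /add_pos; case: eqP => [//|/eqP yd].
    have [|? ? h] := psh y; first by rewrite !inE yd.
    by split=> //; apply: leq_trans h; case: ifP.
  - move=> y yS; have [->|yd] := eqVneq y d.
      (* Once [m = r], no remaining load fits in column 1, so this column is free for [d] even if
         [d] is not the last arrival. *)
      have [em|mr'] := eqVneq m r.
        left; apply: lane_free_new => z zS z1.
        by have [lz _] := psh z zS; rewrite z1 /= em; lia.
      right; split; [lia|by rewrite /add_pos eqxx|].
      by apply: lane_free_new => z zS /(psh' z zS) /=; lia.
    have yS' : y \in S :\ d by rewrite !inE yd.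
    have [f|[mr' y0 f]] := pA y yS'; [left|right].
      exact: lane_free_add.
    split; rewrite // ?{1}/add_pos ?(negbTE yd) //.
    apply: lane_free_add => // _.
    (* The conjunct [m < r] carried with lane 2 forces [a = d] here: the load added to column 2 is
       the last arrival, so it precedes [y] in reverse arrival order. *)
    case/orP: c1 => [/eqP em|/andP[/eqP ad _]]; first by lia.
    by rewrite -ad; apply: amin => //; rewrite ad.
  - move=> y yS; have [->|yd] := eqVneq y d.
      right; split; first by rewrite /add_pos eqxx.
      by apply: lane_free_new => z zS /(psh' z zS) /=; lia.
    have yS' : y \in S :\ d by rewrite !inE yd.
    have dy := dmin _ yS yd.
    case: (pD y yS') => -[y2 f]; [left|right]; 
      (split; [by rewrite /add_pos (negbTE yd)|exact: lane_free_add]).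
have mr' : m < r by move: c2; rewrite negb_or; lia.
have cS := cardsD1 a S; rewrite aS in cS.
have San0 : S :\ a != set0 by rewrite -card_gt0; lia.
(* If [a] differs from [d], then [e] is [d]. If [a = d], column 2 is full and the next departure
   takes column 0. *)
have [e eS emin] := min_rank iD San0.
have cSe := cardsD1 e (S :\ a); rewrite eS in cSe.
have cS2 : #|S :\ a :\ e|.+2 = #|S| by rewrite cS cSe.
have /andP[ea eS1] : (e != a) && (e \in S) by move: eS; rewrite !inE.
have [||||p [pinj psh pA pD]] := IH (S :\ a :\ e) m.+1 q; try by clear - leN cardS cS2 mr' qr; lia.
have psh' y : y \in S :\ a :\ e -> (p y).2 != 2 -> m < (p y).1.
  by move=> /psh[_ _] /[swap] /negbTE ->.
set p1 := add_pos p e (m, 0).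
have p1a y : y \in S :\ a -> (p1 y).2 = 1 -> m < (p1 y).1.
  rewrite /p1 /add_pos; case: eqP => // /eqP ye yS y1.
  by apply: psh'; rewrite ?y1 // !inE ye; move: yS; rewrite !inE.
have sub y : y \in S -> y != a -> y != e -> y \in S :\ a :\ e.
  by move=> yS ya ye; rewrite !inE ya ye.
exists (add_pos p1 a (m, 1)); split.
- apply: add_pos_inj => [|y yS].
    apply: add_pos_inj => // y yS; apply/eqP=> ey.
    by have := psh' y yS; rewrite ey /= ltnn => /(_ isT).
  by apply/eqP=> ey; have := p1a y yS; rewrite ey /= ltnn => /(_ erefl).
- move=> y yS; rewrite /p1 /add_pos.
  case: eqP => [//|/eqP ya]; case: eqP => [//|/eqP ye].
  have [? ? h] := psh y (sub y yS ya ye).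
  by split=> //; apply: leq_trans h; case: ifP.
- move=> y yS; have [->|ya] := eqVneq y a.
    by left; apply: lane_free_new => z zS z1; rewrite leqNgt p1a.
  have ay := amin y yS ya.
  have [ye|ye] := eqVneq y e.
    left; apply: lane_free_add => //; rewrite ye.
    apply: lane_free_new => z zS z1 /=.
    by rewrite leqNgt psh' // z1.
  have [f|[mr2 y0 f]] := pA y (sub y yS ya ye); [left|right].
    by do 2![apply: lane_free_add => //].
  split=> //; first by rewrite /p1 /add_pos (negbTE ya) (negbTE ye).
  by do 2![apply: lane_free_add => //].
move=> y yS; have [->|ya] := eqVneq y a.
  have [ad|ad] := eqVneq a d.
    (* With [a = d], the failed test gives [q = r], so no load of [S] sits in column 2. *)
    right; split; first by rewrite /add_pos eqxx.
    apply: lane_free_new => z zS; rewrite /p1 /add_pos.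
    case: eqP => // /eqP ze z2.
    have [|lz _] := psh z; first by rewrite !inE ze; move: zS; rewrite !inE.
    rewrite z2 /= => qz; move: c2; rewrite ad eqxx negb_or -leqNgt => /andP[_ rq].
    by have := leq_trans rq qz; rewrite leqNgt lz.
  left; split; first by rewrite /add_pos eqxx.
  apply: lane_free_new => z zS; rewrite /p1 /add_pos.
  (* Only [e], in the same row as [a], could block lane 0; it departs no later than [d], hence
     before [a]. *)
  case: (eqVneq z e) => [-> _ _|ze z0].
    have [->|de] := eqVneq e d; first by apply: dmin.
    have dSa : d \in S :\ a by rewrite !inE eq_sym ad.
    by apply: ltn_trans (emin d dSa _) (dmin a aS ad); rewrite eq_sym.
  by rewrite leqNgt psh' ?z0 // !inE ze; move: zS; rewrite !inE.
have [ye|ye] := eqVneq y e.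
  left; split; first by rewrite /p1 /add_pos (negbTE ya) ye eqxx.
  apply: lane_free_add => //; rewrite ye.
  apply: lane_free_new => z zS z1 /=.
  by rewrite leqNgt psh' // z1.
have ey : rkD e < rkD y by apply: emin => //; rewrite !inE ya.
case: (pD y (sub y yS ya ye)) => -[y2 f]; [left|right];
  (split; first by rewrite /p1 /add_pos (negbTE ya) (negbTE ye));
  by do 2![apply: lane_free_add => //].
Qed.

End Lanes.

(** * From lanes to paths of empty cells in the grid *)

Section Grid.

Variables (r c : nat) (L : finType).
Implicit Types (f g : config r c L) (p q : cell r c) (x y : L) (s : seq L).

Lemma adjacent_sym : symmetric (@adjacent r c).
Proof.
move=> p q; rewrite /adjacent /consecutive (eq_sym p.1) (eq_sym p.2).
by congr (_ && _ || _ && _); rewrite orbC.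
Qed.

Lemma empty_path_cons f p q q' :
  adjacent p q -> is_empty f p -> empty_path f q q' -> empty_path f p q'.
Proof.
by move=> pq fp [s [sp sl sf]]; exists (q :: s); split; rewrite /= ?pq ?fp.
Qed.

Lemma empty_path_sym f p q : empty_path f p q -> empty_path f q p.
Proof.
case=> s [sp sl sf]; exists (rev (belast p s)); split.
- by rewrite -sl rev_path (eq_path (e' := @adjacent r c)) // => u v;
    rewrite adjacent_sym.
- by case: s sl {sp sf} => [|u s] //= _; rewrite rev_cons last_rcons.
by rewrite -sl -rev_rcons -lastI all_rev.
Qed.

Lemma column_path f (i : 'I_r.+1) (j : 'I_c) :
  (forall i' : 'I_r.+1, i' <= i -> is_empty f (i', j)) ->
  empty_path f (i, j) (ord0, j).
Proof.
case: i => i; elim: i => [|i IH] ir fe.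
  exists [::]; split=> //=; last by rewrite fe.
  by congr pair; apply: val_inj.
apply: (empty_path_cons (q := (Ordinal (ltnW ir), j))) (fe _ _) (IH _ _) => //.
  by rewrite /adjacent /consecutive /= !eqxx !orbT.
by move=> i' /= i'i; apply: fe => /=; apply: leqW.
Qed.

(** At most one horizontal step, then straight down. The bound is [w.1.+1] because row 0 of [cell]
    is the I/O row. *)
Lemma lane_path f (w : wcell r c) (j : 'I_c) :
  (j == w.2) || consecutive w.2 j -> is_empty f (cell_of_wcell w) ->
  (forall i' : 'I_r.+1, i' <= w.1.+1 -> is_empty f (i', j)) ->
  empty_path f (cell_of_wcell w) (ord0, j).
Proof.
move=> jw fw fj.
have cp : empty_path f (lift ord0 w.1, j) (ord0, j) by apply: column_path.
case/orP: jw => [/eqP jw|jw]; first by rewrite /cell_of_wcell -jw.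
by apply: empty_path_cons cp; rewrite // /adjacent /= eqxx jw.
Qed.

Lemma cell_of_wcell_inj : injective (@cell_of_wcell r c).
Proof. by move=> [i j] [i' j'] [e ->]; congr pair; apply: val_inj. Qed.

(** With one action per load, every intermediate configuration has this form: a load is absent or in
    its final cell. *)
Definition config_on (a : {ffun L -> wcell r c}) (P : pred L) : config r c L :=
  [ffun x => if P x then Some (cell_of_wcell (a x)) else None].

(* [R y x] reads: y is out of the way when x moves. *)
Definition lane_order (a : {ffun L -> wcell r c}) (R : rel L) (x : L) : Prop :=
  exists2 j : 'I_c, (j == (a x).2) || consecutive (a x).2 j &
    forall y, y != x -> (a y).2 = j -> (a y).1 <= (a x).1 -> R y x.

Lemma lane_order_path (a : {ffun L -> wcell r c}) (R : rel L) (P : pred L) x :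
  injective a -> lane_order a R x -> ~~ P x -> (forall y, P y -> ~~ R y x) ->
  exists j, empty_path (config_on a P) (cell_of_wcell (a x)) (ord0, j).
Proof.
move=> ainj [j jx lane] Px PR; exists j; apply: lane_path => //.
  apply/forallP => y; rewrite ffunE; case: ifP => // Py.
  apply/eqP=> /Some_inj/cell_of_wcell_inj/ainj yx.
  by rewrite -yx Py in Px.
move=> i ix; apply/forallP => y; rewrite ffunE; case: ifP => // Py.
apply/eqP=> -[iy jy]; move/negP: (PR y Py); apply; apply: lane => //.
  by apply: contraNneq Px => <-.
by move: ix; rewrite -iy.
Qed.

Lemma perform_retrieval (a : {ffun L -> wcell r c}) (s : seq L) :
  injective a -> uniq s ->
  (forall x, x \in s -> lane_order a [rel y x | index y s < index x s] x) ->
  (forall x, x \in s) ->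
  perform (@retrieval_action r c L) s (config_of a) (no_load r c L).
Proof.
move=> ainj us lane sT.
suff H t u : s = u ++ t ->
    perform (@retrieval_action r c L) t (config_on a (mem t)) (no_load r c L).
  have -> : config_of a = config_on a (mem s).
    by apply/ffunP => x; rewrite !ffunE /= sT.
  exact: (H s [::]).
elim: t u => [|x t IH] u su /=; first by apply/ffunP => x; rewrite !ffunE.
have xs : x \in s by rewrite sT.
move: (us); rewrite su cat_uniq /= => /and4P[_ /norP[xu ut] xt _].
have E : set_load (config_on a (mem (x :: t))) x None = config_on a (mem t).
  apply/ffunP => y; rewrite !ffunE /= !inE.
  by case: eqP => [->|] //=; rewrite (negbTE xt).
exists (config_on a (mem t)); last by apply: (IH (rcons u x)); rewrite cat_rcons.
have [|j ej] := lane_order_path (P := mem t) ainj (lane x xs) xt.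
  move=> y yt /=; rewrite su !index_cat (negbTE xu) /= eqxx addn0 -leqNgt.
  by case: ifP => [yu|_]; [case/hasP: ut; exists y | rewrite leq_addr].
exists (a x), (ord0, j); split; rewrite ?E //.
by rewrite ffunE /= inE eqxx.
Qed.

(** Storage is retrieval run backwards: the outgoing path of [x] is reversed, and the loads in its
    lane must arrive after [x]. *)
Lemma perform_storage (a : {ffun L -> wcell r c}) (s : seq L) :
  injective a -> uniq s ->
  (forall x, x \in s -> lane_order a [rel y x | index x s < index y s] x) ->
  (forall x, x \in s) ->
  perform (@storage_action r c L) s (no_load r c L) (config_of a).
Proof.
move=> ainj us lane sT.
suff H t u : s = u ++ t ->
    perform (@storage_action r c L) t (config_on a (mem u)) (config_of a).
  have -> : no_load r c L = config_on a (mem [::]).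
    by apply/ffunP => x; rewrite !ffunE.
  exact: (H s [::]).
elim: t u => [|x t IH] u su /=.
  by apply/ffunP => x; rewrite !ffunE /= -[u]cats0 -su sT.
have xs : x \in s by rewrite sT.
move: (us); rewrite su cat_uniq /= => /and4P[_ /norP[xu ut] xt _].
have E : set_load (config_on a (mem u)) x (Some (cell_of_wcell (a x)))
    = config_on a (mem (rcons u x)).
  apply/ffunP => y; rewrite !ffunE /= mem_rcons !inE.
  by case: eqP => [->|] //=.
exists (config_on a (mem (rcons u x))); last by apply: IH; rewrite cat_rcons.
have [|j ej] := lane_order_path (P := mem u) ainj (lane x xs) xu.
  move=> y yu /=; rewrite su !index_cat (negbTE xu) /= eqxx addn0 -leqNgt.
  by rewrite [y \in u]yu ltnW // index_mem.
split; first by rewrite ffunE /= (negbTE xu).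
by exists (ord0, j), (a x); split; rewrite ?E //; apply: empty_path_sym.
Qed.

End Grid.

(** * Residue classes modulo [k.+1] and assembly of the blocks *)

Lemma bounded_perturbation_index (k n : nat) (D' : seq 'I_n) (x y : 'I_n) :
  bounded_perturbation k (enum 'I_n) D' -> y < x ->
  y = x %[mod k.+1] -> index y D' < index x D'.
Proof.
move=> [pD bD] yx /eqP yxm; rewrite ltnNge leq_eqVlt; apply/negP => /orP[/eqP e|lt].
  have mD z : z \in D' by rewrite (perm_mem pD) mem_enum.
  have : nth x D' (index x D') = nth x D' (index y D') by rewrite e.
  by rewrite !nth_index // => xy; rewrite xy ltnn in yx.
(* Positions in [enum 'I_n] are the labels, so an inversion would give [x - y <= k], although
   [x - y] is a positive multiple of [k.+1]. *)
have := bD x y x; rewrite size_enum_ord yx ltn_ord !nth_ord_enum.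
move=> /(_ isT lt) xyk.
move: yxm; rewrite eq_sym eqn_mod_dvd ?(ltnW yx) // => /dvdn_leq.
by rewrite subn_gt0 yx => /(_ isT); lia.
Qed.

Lemma card_residue_class (k m g : nat) :
  g < k.+1 -> #|[set x : 'I_(m * k.+1) | x %% k.+1 == g]| = m.
Proof.
move=> gk.
have h (i : 'I_m) : i * k.+1 + g < m * k.+1 by case: i => i /= im; nia.
rewrite -[RHS]card_ord -(card_imset (f := fun i => Ordinal (h i))); last first.
  by move=> i j [] /addIn/eqP; rewrite eqn_pmul2r // => /eqP /val_inj.
apply: eq_card => x; rewrite !inE; apply/eqP/imsetP => [xg|[i _ ->]] /=.
  have xm : x %/ k.+1 < m by rewrite ltn_divLR.
  by exists (Ordinal xm) => //; apply: val_inj; rewrite /= -xg -divn_eq.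
by rewrite modnMDl modn_small.
Qed.

Theorem theorem2 (k r c n : nat) (hk : 0 < k) (hr : 1 <= r)
    (hc : c = 3 * k + 3) (hn : n = r * c)
    (A : seq 'I_n) (hA : perm_eq A (enum 'I_n)) :
  @zero_relocation_solution r c 'I_n A (enum 'I_n) k.
Proof.
have uA : uniq A by rewrite (perm_uniq hA) enum_uniq.
have mA x : x \in A by rewrite (perm_mem hA) mem_enum.
(* Later arrivals get smaller ranks; truncation does no harm, as all indices are below [n]. *)
pose rkA x := n - index x A.
have sA : size A = n by rewrite (perm_size hA) size_enum_ord.
have ltA x : index x A < n by have := mA x; rewrite -index_mem sA.
have iA : injective rkA.
  move=> x y; rewrite /rkA => e.
  have exy : index x A = index y A by have := ltA x; have := ltA y; lia.
  by rewrite -(nth_index x (mA x)) exy nth_index.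
pose S (g : 'I_k.+1) := [set x : 'I_n | x %% k.+1 == g].
(* Since [n = 3 * r * k.+1], each class exactly fills an empty block, the case [m = q = 0]. *)
have cS g : #|S g| = 2 * (r - 0) + (r - 0).
  rewrite /S; have -> : 2 * (r - 0) + (r - 0) = 3 * r by lia.
  have e : n = 3 * r * k.+1 by lia.
  by move: g {S}; rewrite e => g; apply: card_residue_class.
have [p pP] := fin_all_exists (fun g => block_arrangement iA
  (@ord_inj n) (leq0n r) (leq0n r) (cS g)).
pose cls (x : 'I_n) : 'I_k.+1 := Ordinal (ltn_pmod x (ltn0Sn k)).
have xS x : x \in S (cls x) by rewrite inE.
pose row x := (p (cls x) x).1; pose col x := (p (cls x) x).2.
have rowP x : row x < r by have [_ /(_ x (xS x))[]] := pP (cls x).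
have col3 x : col x < 3 by have [_ /(_ x (xS x))[]] := pP (cls x).
(* Class [g] occupies the columns from [3 * g] to [3 * g + 2]. *)
have colP x : 3 * cls x + col x < c.
  by have := col3 x; have := ltn_ord (cls x); lia.
pose a := [ffun x => (Ordinal (rowP x), Ordinal (colP x))].
have ainj : injective a.
  move=> x y; rewrite !ffunE => -[er ec].
  have e : cls x = cls y.
    by apply: val_inj; have := col3 x; have := col3 y; move: ec => /=; lia.
  have ecol : col x = col y by case: e ec => /= -> /addnI.
  have epos z : p (cls z) z = (row z, col z) by apply: surjective_pairing.
  have [pinj _ _ _] := pP (cls y); apply: pinj => //; first by rewrite -e.
  by rewrite epos -{1}e epos er ecol.
(* Other classes lie in other blocks, so [R] has to follow from [rk] only within the class of
   [x]. *)
have lane (R : rel 'I_n) (rk : 'I_n -> nat) x (j : nat) :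
    (forall y, cls y = cls x -> rk y < rk x -> R y x) ->
    j < 3 -> (j == col x) || consecutive (col x) j ->
    lane_free rk (S (cls x)) (p (cls x)) x j -> lane_order a R x.
  move=> Rrk j3 jx free.
  have jc : 3 * cls x + j < c by have := ltn_ord (cls x); lia.
  exists (Ordinal jc).
    rewrite ffunE -val_eqE /= eqn_add2l /consecutive -!addnS !eqn_add2l.
    exact: jx.
  move=> y yx; rewrite !ffunE => -[ec] /= le.
  have e : cls y = cls x.
    by apply: val_inj; have := col3 y; move: ec => /=; lia.
  apply: Rrk => //; apply: free => //.
  - by rewrite -e xS.
  - by rewrite -e; case: e ec => /= -> /addnI.
  by rewrite -{1}e.
exists a; split=> //.
- apply: perform_storage => // x _.
  have RA y : cls y = cls x -> rkA y < rkA x -> index x A < index y A.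
    by move=> _; apply: contraTT; rewrite -!leqNgt; apply: leq_sub2l.
  have [_ _ /(_ x (xS x)) + _] := pP (cls x).
  move: (col3 x); rewrite -/(col x) => c3 [f|[_ c0 f]]; apply: lane f => //.
    by move: (col x) c3 => [|[|[|]]].
  by move: (col x) c3 c0 => [|[|[|]]].
move=> D' bD; have pD := bD.1.
apply: perform_retrieval => //.
- by rewrite (perm_uniq pD) enum_uniq.
- move=> x _.
  have RD (y : 'I_n) : cls y = cls x -> y < x -> index y D' < index x D'.
    by move=> [e] yx; apply: bounded_perturbation_index bD yx _.
  have [_ _ _ /(_ x (xS x))] := pP (cls x).
  move: (col3 x); rewrite -/(col x) => c3 [[c0 f]|[c0 f]]; apply: lane f => //;
    by move: (col x) c3 c0 => [|[|[|]]].
by move=> x; rewrite (perm_mem pD) mem_enum.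
Qed.
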